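(* Let $n\ge2$, $k\ge0$, $\nu_1,\ldots,\nu_n>0$. The set of polynomials \[ \psi^{BG}_{j_1,\ldots,j_{n-1}}=CK_n^{BG}\Big(\big(L_+^{[n-1]}\big)^{j_{n-1}}CK_{n-1}^{BG}\Big(\cdots\big(L_+^{[2]}\big)^{j_2}CK_2^{BG}\big(x_1^{j_1}\big)\cdots\Big)\Big), \] where $(j_1,\ldots,j_{n-1})$ ranges over nonnegative integer tuples with $\sum_{\ell=1}^{n-1}j_\ell=k$, is a basis of $\mathcal{H}^{BG}_k(\mathbb{R}^n)$.
   Context: For $m\le n$: $L_-^{[m]}=\sum_{j=1}^m\big(x_j\partial_{x_j}^2+2\nu_j\partial_{x_j}\big)$, $L_+^{[m]}=\sum_{j=1}^m x_j$ (multiplication). $\mathcal{H}^{BG}_k(\mathbb{R}^n)$ is the space of real homogeneous degree-$k$ polynomials in $x_1,\ldots,x_n$ annihilated by $L_-^{[n]}$. For $2\le m\le n$ and a homogeneous polynomial $p$ of degree $d$ in $x_1,\ldots,x_{m-1}$, $CK_m^{BG}(p)=\Gamma(2\nu_m)\sum_{j=0}^d\frac{(-x_mL_-^{[m-1]})^j}{j!\,\Gamma(j+2\nu_m)}p$. *)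

(* Defs.v *)
From HB Require Import structures.
From mathcomp Require Import all_boot all_order all_algebra.
From mathcomp Require Import mpoly.
Set Implicit Arguments. Unset Strict Implicit. Unset Printing Implicit Defensive.
Import Order.TTheory GRing.Theory Num.Theory.
Local Open Scope ring_scope.

(* Polynomials in x_1, ..., x_n are elements of {mpoly R[n]}; the variable
   x_j (1-based, 1 <= j <= n) is 'X_(j-1).  Parameters nu_j are 1-based:
   nu : nat -> R, only nu 1, ..., nu n matter. *)

Section BG.
Variables (R : realFieldType) (n : nat) (nu : nat -> R).

(* x_j, 1-based; (0 outside 1 <= j <= n, never used there) *)
Definition xvar (j : nat) : {mpoly R[n]} :=
  if @insub nat (fun i => i < n)%N 'I_n j.-1 is Some i then 'X_i else 0.

Definition dvar (j : nat) (p : {mpoly R[n]}) : {mpoly R[n]} :=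
  if @insub nat (fun i => i < n)%N 'I_n j.-1 is Some i then mderiv i p else 0.

Definition Lminus (m : nat) (p : {mpoly R[n]}) : {mpoly R[n]} :=
  \sum_(1 <= j < m.+1) (xvar j * dvar j (dvar j p) + (2 * nu j) *: dvar j p).

Definition Lplus (m : nat) (p : {mpoly R[n]}) : {mpoly R[n]} :=
  (\sum_(1 <= j < m.+1) xvar j) * p.

(* Pochhammer symbol (a)_j = a (a+1) ... (a+j-1) = Gamma(j+a)/Gamma(a), a > 0 *)
Definition pochhammer (a : R) (j : nat) : R := \prod_(i < j) (a + i%:R).

(* CK_m^{BG}(p) for p homogeneous of degree d in x_1..x_{m-1}:
   Gamma(2nu_m) sum_{j=0}^d (-x_m L_-^{[m-1]})^j p / (j! Gamma(j + 2 nu_m)) *)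
Definition CK (m d : nat) (p : {mpoly R[n]}) : {mpoly R[n]} :=
  \sum_(0 <= j < d.+1)
     ((j`!)%:R * pochhammer (2 * nu m) j)^-1 *:
       iter j (fun q => - (xvar m * Lminus m.-1 q)) p.

Definition HBG (k : nat) (p : {mpoly R[n]}) : Prop :=
  p \is @ishomog1 n R k mdeg /\ Lminus n p = 0.

(* Index set: tuples (j_1, ..., j_{n-1}) of nonnegative integers summing to k;
   j_l is stored as t (l-1) : 'I_k.+1 (automatically <= k). *)
Definition idx_ok (k : nat) (t : {ffun 'I_n.-1 -> 'I_k.+1}) : bool :=
  (\sum_(l < n.-1) (t l : nat) == k)%N.

Definition jidx (k : nat) (t : {ffun 'I_n.-1 -> 'I_k.+1}) (l : nat) : nat :=
  if @insub nat (fun i => i < n.-1)%N 'I_n.-1 l.-1 is Some i then t i else 0%N.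

(* phi_m := CK_m((L_+^{[m-1]})^{j_{m-1}} CK_{m-1}( ... (L_+^{[2]})^{j_2} CK_2(x_1^{j_1}))),
   for m >= 2 (phi_0, phi_1 are unused and set to 0).  The polynomial fed
   to CK_m is homogeneous of degree d = j_1 + ... + j_{m-1} in x_1..x_{m-1}. *)
Fixpoint phi (k : nat) (t : {ffun 'I_n.-1 -> 'I_k.+1}) (m : nat) : {mpoly R[n]} :=
  match m with
  | 0 | 1 => 0
  | 2 => CK 2 (jidx t 1) (xvar 1 ^+ jidx t 1)
  | m'.+1 =>
      CK m (\sum_(1 <= l < m) jidx t l)
         (iter (jidx t m') (Lplus m') (phi t m'))
  end.

Definition psiBG (k : nat) (t : {ffun 'I_n.-1 -> 'I_k.+1}) : {mpoly R[n]} :=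
  phi t n.

End BG.

(* Main.v *)
(** The operators L_- and L_+ on polynomials in x_1, ..., x_m satisfy the sl_2 relation
    [L_-, L_+] = 2 E + 2 (nu_1 + ... + nu_m), E being the Euler operator.  Hence
    L_- L_+^(j+1) h is a nonzero multiple of L_+^j h for h harmonic, and every homogeneous
    polynomial in x_1, ..., x_m is uniquely a sum of L_+^j h_j with h_j harmonic (Fischer
    decomposition).  On the other hand CK_(m+1) is a bijection from the homogeneous polynomials in
    x_1, ..., x_m onto the harmonic ones in x_1, ..., x_(m+1), inverse to the restriction to
    x_(m+1) = 0.  Composing the two, a basis for m variables, in all degrees at most d, yields one
    for m + 1 variables in degree d. *)

Require Import Defs.
From HB Require Import structures.
From mathcomp Require Import all_boot all_order all_algebra.
From mathcomp Require Import mpoly ring.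
Set Implicit Arguments. Unset Strict Implicit. Unset Printing Implicit Defensive.
Import Order.TTheory GRing.Theory Num.Theory.
Local Open Scope ring_scope.

(** * Iterates of linear maps *)

Section IterLinear.
Variables (R : comNzRingType) (V : lmodType R) (f : {linear V -> V}).

Lemma iter_is_linear (j : nat) : linear (iter j f).
Proof. by elim: j => // j IHj a p q /=; rewrite IHj linearP. Qed.

HB.instance Definition _ (j : nat) :=
  GRing.isLinear.Build R V V _ (iter j f) (iter_is_linear j).

End IterLinear.

(** * Coefficients of products with a variable, and of the restriction to x_i = 0 *)

Section Coefficients.
Variables (R : nzRingType) (n : nat).
Implicit Types (p : {mpoly R[n]}) (s : 'X_{1..n}).

Lemma mcoeff_mulX i p s : ('X_i * p)@_s = if s i == 0%N then 0 else p@_(s - U_(i))%MM.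
Proof.
rewrite -(commr_mpolyX U_(i)%MM p); case: eqP => [si0 | /eqP si_neq0].
  apply/eqP; rewrite mcoeff_eq0 (perm_mem (msuppMX _ _)).
  apply/mapP => -[s' _ def_s]; move: si0.
  by rewrite def_s mnmDE mnm1E eqxx.
have le_U : (U_(i) <= s)%MM by rewrite lep1mP.
by rewrite -{1}(submK le_U) addmC mcoeffMX.
Qed.

(** Substitution of 0 for x_i, done by discarding the monomials that contain x_i. *)
Definition restrict0 (i : 'I_n) p : {mpoly R[n]} :=
  \sum_(s <- msupp p) (p@_s *+ (s i == 0%N)) *: 'X_[s].

Lemma mcoeff_restrict0 i p s : (restrict0 i p)@_s = p@_s *+ (s i == 0%N).
Proof.
rewrite /restrict0 raddf_sum /=.
under eq_bigr do rewrite mcoeffZ mcoeffX.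
have [s_in | s_notin] := boolP (s \in msupp p).
  rewrite (bigD1_seq s) ?msupp_uniq //= eqxx mulr1 big1 ?addr0 // => s' /negPf->.
  by rewrite mulr0.
rewrite (memN_msupp_eq0 s_notin) mul0rn big1_seq // => s' /andP[_ s'_in].
by case: (s' =P s) s'_in => [-> | _ _]; [rewrite (negPf s_notin) | rewrite mulr0].
Qed.

End Coefficients.

(** * One-variable Bessel operators, their commutators with the variables, and explicit CK sums *)

Section BesselOperators.
Variables (R : realFieldType) (n : nat) (nu : nat -> R).
Implicit Types (p q h : {mpoly R[n]}) (i : 'I_n) (m d : nat) (s : 'X_{1..n}).

(** One summand of L_-. Ordinals count from 0 and [nu] from 1, hence [nu i.+1]. *)
Definition bessel i p : {mpoly R[n]} :=
  'X_i * p^`M(i)^`M(i) + (2 * nu i.+1) *: p^`M(i).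

Lemma xvarE i : xvar R n i.+1 = 'X_i.
Proof. by rewrite /xvar /= valK. Qed.

Lemma dvarE i p : dvar i.+1 p = p^`M(i).
Proof. by rewrite /dvar /= valK. Qed.

Lemma dvar_is_linear m : linear (@dvar R n m).
Proof. by move=> a p q; rewrite /dvar; case: insub => [i|]; rewrite ?linearP // scaler0 addr0. Qed.

HB.instance Definition _ m :=
  GRing.isLinear.Build R {mpoly R[n]} {mpoly R[n]} _ (@dvar R n m) (dvar_is_linear m).

Lemma Lminus_is_linear m : linear (@Lminus R n nu m).
Proof.
move=> a p q; rewrite /Lminus scaler_sumr -big_split; apply: eq_bigr => j _ /=.
by rewrite !linearP /= -!mul_mpolyC; ring.
Qed.

HB.instance Definition _ m :=
  GRing.isLinear.Build R {mpoly R[n]} {mpoly R[n]} _ (@Lminus R n nu m) (Lminus_is_linear m).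

Lemma Lplus_is_linear m : linear (@Lplus R n m).
Proof. by move=> a p q; rewrite /Lplus mulrDr scalerAr. Qed.

HB.instance Definition _ m :=
  GRing.isLinear.Build R {mpoly R[n]} {mpoly R[n]} _ (@Lplus R n m) (Lplus_is_linear m).

Lemma sum_1based (V : nmodType) m (F : nat -> V) : (m <= n)%N ->
  \sum_(1 <= j < m.+1) F j = \sum_(i < n | (i < m)%N) F i.+1.
Proof. by move=> le_mn; rewrite big_add1 big_mkord (big_ord_widen _ (fun j => F j.+1) le_mn). Qed.

Lemma LminusE m p : (m <= n)%N -> Lminus nu m p = \sum_(i < n | (i < m)%N) bessel i p.
Proof.
by move=> le_mn; rewrite /Lminus sum_1based //; apply: eq_bigr => i _; rewrite xvarE !dvarE.
Qed.

Lemma LplusE m p : (m <= n)%N -> Lplus m p = \sum_(i < n | (i < m)%N) 'X_i * p.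
Proof.
move=> le_mn; rewrite /Lplus sum_1based // mulr_suml.
by apply: eq_bigr => i _; rewrite xvarE.
Qed.

Lemma bessel_is_linear i : linear (bessel i).
Proof. by move=> a p q; rewrite /bessel !linearP /= -!mul_mpolyC; ring. Qed.

HB.instance Definition _ i :=
  GRing.isLinear.Build R {mpoly R[n]} {mpoly R[n]} _ (bessel i) (bessel_is_linear i).

Lemma LminusS i p : Lminus nu i.+1 p = Lminus nu i p + bessel i p.
Proof. by rewrite /Lminus big_nat_recr //= xvarE !dvarE. Qed.

Lemma mcoeff_bessel i p s :
  (bessel i p)@_s = (s i).+1%:R * ((s i)%:R + 2 * nu i.+1) * p@_(s + U_(i))%MM.
Proof.
rewrite mcoeffD mcoeffZ mcoeff_mulX !mcoeff_deriv.
case: eqP => [-> | /eqP si_neq0]; first by rewrite -mulr_natr; ring.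
have le_U : (U_(i) <= s)%MM by rewrite lep1mP.
rewrite submK // mnmBE mnm1E eqxx subn1 prednK ?lt0n //.
move: (p@__) (s i) (nu _) => x k a.
by rewrite -[x *+ _ *+ _]mulr_natr -[x *+ _]mulr_natr -natr1; ring.
Qed.

Lemma mderivXU (i j : 'I_n) : 'X_j^`M(i) = (i == j)%:R :> {mpoly R[n]}.
Proof.
rewrite mderivX mnm1E eq_sym; case: eqP => [->|_]; last by rewrite scale0r.
have -> : (U_(j) - U_(j))%MM = 0%MM by apply/mnmP=> l; rewrite mnmBE subnn mnm0E.
by rewrite scale1r mpolyX0.
Qed.

(** The commutator of the Bessel operator with x_i is 2 x_i d/dx_i + 2 nu_i; summed over i, this
    becomes the sl_2 relation. *)
Lemma bessel_mulX (i j : 'I_n) p :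
  bessel i ('X_j * p) = 'X_j * bessel i p
    + (i == j)%:R *: (2 *: ('X_i * p^`M(i)) + (2 * nu i.+1) *: p).
Proof.
rewrite /bessel !(mderivM, mderivD, mderivXU).
case: eqP => [<-|_]; rewrite /= ?scale1r ?scale0r.
  rewrite -(mpolyC1 n R) mderivC -!mul_mpolyC !mpolyCM mpolyC1 mpolyC_nat; ring.
by rewrite mderiv0 -!mul_mpolyC; ring.
Qed.

Lemma mderiv_mulXn i h j : h^`M(i) = 0 ->
  ('X_i ^+ j.+1 * h)^`M(i) = j.+1%:R *: ('X_i ^+ j * h).
Proof.
move=> dh0; elim: j => [|j IHj].
  by rewrite expr1 mderivM dh0 mulr0 addr0 mderivXU eqxx scale1r expr0.
rewrite exprS -mulrA mderivM IHj mderivXU eqxx mul1r -scalerAr mulrA -exprS.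
by rewrite -[X in X + _]scale1r -scalerDl nat1r.
Qed.

(** The scalar is exactly the ratio of consecutive denominators j! (2 nu)_j in the CK series. *)
Lemma bessel_mulXn i h j : h^`M(i) = 0 ->
  bessel i ('X_i ^+ j.+1 * h) = (j.+1%:R * (j%:R + 2 * nu i.+1)) *: ('X_i ^+ j * h).
Proof.
move=> dh0; elim: j => [|j IHj].
  rewrite expr1 bessel_mulX eqxx /bessel dh0 mderiv0 !(mulr0, scaler0, addr0, add0r).
  by rewrite expr0 mul1r scale1r mul1r.
rewrite exprS -mulrA bessel_mulX eqxx IHj scale1r mderiv_mulXn //.
rewrite -!scalerAr !mulrA -!exprS !scalerA -!scalerDl; congr (_ *: _).
ring.
Qed.

Lemma Lminus_mulX m i p : (m <= i)%N -> Lminus nu m ('X_i * p) = 'X_i * Lminus nu m p.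
Proof.
move=> le_mi; rewrite !LminusE ?(leq_trans le_mi (ltnW (ltn_ord i))) // mulr_sumr.
apply: eq_bigr => l lt_lm; rewrite bessel_mulX; case: eqP lt_lm => [-> | _ _].
  by rewrite ltnNge le_mi.
by rewrite scale0r addr0.
Qed.

Lemma Lminus_mulXn m i j p : (m <= i)%N ->
  Lminus nu m ('X_i ^+ j * p) = 'X_i ^+ j * Lminus nu m p.
Proof.
move=> le_mi; elim: j => [|j IHj]; first by rewrite !mul1r.
by rewrite exprS -!mulrA Lminus_mulX // IHj.
Qed.

(** The new variable commutes with L_- in the earlier variables, so its powers can be collected in
    front. *)
Lemma iter_CK_step i p j :
  iter j (fun q => - (xvar R n i.+1 * Lminus nu i q)) p
    = (-1) ^+ j *: ('X_i ^+ j * iter j (Lminus nu i) p).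
Proof.
elim: j => [|j IHj]; first by rewrite scale1r mul1r.
rewrite [LHS]/= IHj xvarE linearZ /=.
by rewrite Lminus_mulXn // -scalerAr mulrA -exprS -scaleNr -mulN1r -exprS.
Qed.

Lemma CK_explicit i d p :
  CK nu i.+1 d p = \sum_(j < d.+1)
    ((j`!)%:R * pochhammer (2 * nu i.+1) j)^-1 *:
      ((-1) ^+ j *: ('X_i ^+ j * iter j (Lminus nu i) p)).
Proof. by rewrite /CK big_mkord; apply: eq_bigr => j _; rewrite iter_CK_step. Qed.

Lemma CK_is_linear i d : linear (@CK R n nu i.+1 d).
Proof.
move=> a p q; rewrite !CK_explicit scaler_sumr -big_split; apply: eq_bigr => j _ /=.
rewrite iter_is_linear mulrDr !scalerDr -scalerAr; congr (_ + _).
by rewrite !scalerA; congr (_ *: _); ring.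
Qed.

HB.instance Definition _ i d :=
  GRing.isLinear.Build R {mpoly R[n]} {mpoly R[n]} _ (@CK R n nu i.+1 d) (CK_is_linear i d).

End BesselOperators.

(** * Homogeneous and harmonic polynomials in the first m variables *)

Section Harmonics.
Variables (R : realFieldType) (n : nat) (nu : nat -> R).
Hypothesis nu_gt0 : forall j, (1 <= j <= n)%N -> 0 < nu j.
Implicit Types (p q h : {mpoly R[n]}) (i : 'I_n) (m d : nat) (s : 'X_{1..n}).

(** Homogeneity of degree d in x_1, ..., x_m, phrased on coefficients inside the ambient n
    variables; 0 qualifies in every degree. *)
Definition homin m d p : Prop :=
  forall s, p@_s != 0 -> mdeg s = d /\ forall i, (m <= i)%N -> s i = 0%N.

Definition harm m d p : Prop := homin m d p /\ Lminus nu m p = 0.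

Lemma nu_ord_gt0 i : 0 < nu i.+1.
Proof. by apply: nu_gt0; rewrite /= ltn_ord. Qed.

Lemma homin0 m d : homin m d 0.
Proof. by move=> s; rewrite mcoeff0 eqxx. Qed.

Lemma hominD m d p q : homin m d p -> homin m d q -> homin m d (p + q).
Proof.
move=> hp hq s; rewrite mcoeffD; have [->|/hp //] := eqVneq p@_s 0.
by rewrite add0r => /hq.
Qed.

Lemma hominZ m d a p : homin m d p -> homin m d (a *: p).
Proof. by move=> hp s; rewrite mcoeffZ mulf_eq0 negb_or => /andP[_ /hp]. Qed.

Lemma hominB m d p q : homin m d p -> homin m d q -> homin m d (p - q).
Proof. by move=> hp hq; rewrite -[- q]scaleN1r; apply/hominD/hominZ. Qed.

Lemma harmZ m d a h : harm m d h -> harm m d (a *: h).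
Proof. by move=> [hh Lh0]; split; [apply: hominZ | rewrite linearZ /= Lh0 scaler0]. Qed.

Lemma homin_sum m d (I : Type) (r : seq I) (P : pred I) (F : I -> {mpoly R[n]}) :
  (forall j, P j -> homin m d (F j)) -> homin m d (\sum_(j <- r | P j) F j).
Proof. by move=> hF; elim/big_rec: _ => [|j p /hF]; [apply: homin0 | apply: hominD]. Qed.

Lemma homin_widen m m' d p : (m <= m')%N -> homin m d p -> homin m' d p.
Proof. by move=> le_m hp s /hp[? hs]; split=> // i /(leq_trans le_m)/hs. Qed.

Lemma homin_mulX m d i p : (i < m)%N -> homin m d p -> homin m d.+1 ('X_i * p).
Proof.
move=> lt_im hp s; rewrite mcoeff_mulX; have [_|si] := eqVneq (s i) 0%N; first by rewrite eqxx.
have le_U : (U_(i) <= s)%MM by rewrite lep1mP.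
case/hp => deg_s s0; split.
  by rewrite -(submK le_U) mdegD mdeg1 deg_s addn1.
move=> l le_ml; move: (s0 l le_ml); rewrite mnmBE mnm1E.
case: eqP => [def_l | _]; last by rewrite subn0.
by move: le_ml; rewrite -def_l leqNgt lt_im.
Qed.

Lemma homin_mulXn m d i j p : (i < m)%N -> homin m d p -> homin m (j + d) ('X_i ^+ j * p).
Proof.
move=> lt_im hp; elim: j => [|j IHj]; first by rewrite mul1r.
by rewrite exprS -mulrA addSn; apply: homin_mulX.
Qed.

Lemma homin_Lplus m d p : (m <= n)%N -> homin m d p -> homin m d.+1 (Lplus m p).
Proof. by move=> le_mn hp; rewrite LplusE //; apply: homin_sum => i lt_im; apply: homin_mulX. Qed.

Lemma homin_iter_Lplus m d j p : (m <= n)%N ->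
  homin m d p -> homin m (j + d) (iter j (Lplus m) p).
Proof. by move=> le_mn hp; elim: j => //= j; apply: homin_Lplus. Qed.

Lemma mcoeff_Lminus m p s : (m <= n)%N ->
  (Lminus nu m p)@_s
    = \sum_(i < n | (i < m)%N) (s i).+1%:R * ((s i)%:R + 2 * nu i.+1) * p@_(s + U_(i))%MM.
Proof.
by move=> le_mn; rewrite LminusE // raddf_sum; apply: eq_bigr => i _; apply: mcoeff_bessel.
Qed.

(** A monomial s of L_- p comes from some s + U_i in p. Stating d as a successor covers both the
    drop in degree and the vanishing in degree 0. *)
Lemma homin_Lminus_neq0 m d p s : (m <= n)%N -> homin m d p -> (Lminus nu m p)@_s != 0 ->
  d = (mdeg s).+1 /\ forall i, (m <= i)%N -> s i = 0%N.
Proof.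
move=> le_mn hp; rewrite mcoeff_Lminus //.
have [i /andP[lt_im nz]| all0] := pickP [pred i : 'I_n | (i < m)%N & p@_(s + U_(i))%MM != 0].
  move=> _; have [<- s0] := hp _ nz; split; first by rewrite mdegD mdeg1 addn1.
  by move=> l /s0 /eqP; rewrite mnmDE addn_eq0 => /andP[/eqP].
rewrite big1 ?eqxx // => i lt_im; have := all0 i; rewrite /= lt_im /= => /negbFE/eqP->.
by rewrite mulr0.
Qed.

Lemma homin_Lminus m d p : (m <= n)%N -> homin m d.+1 p -> homin m d (Lminus nu m p).
Proof. by move=> le_mn hp s /(homin_Lminus_neq0 le_mn hp)[[->]]. Qed.

Lemma Lminus_homin0 m p : (m <= n)%N -> homin m 0 p -> Lminus nu m p = 0.
Proof.
move=> le_mn hp; apply/mpolyP => s; rewrite mcoeff0; apply/eqP.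
by apply: contraT => /(homin_Lminus_neq0 le_mn hp)[].
Qed.

Lemma homin_iter_Lminus m d j p : (m <= n)%N -> (j <= d)%N ->
  homin m d p -> homin m (d - j) (iter j (Lminus nu m) p).
Proof.
move=> le_mn; elim: j => [|j IHj] lt_jd hp; first by rewrite subn0.
by apply: homin_Lminus; rewrite // subnSK //; apply: IHj; first apply: ltnW.
Qed.

Lemma iter_Lminus_eq0 m d p : (m <= n)%N -> homin m d p -> iter d.+1 (Lminus nu m) p = 0.
Proof.
move=> le_mn hp; apply: Lminus_homin0 => //.
by have := homin_iter_Lminus le_mn (leqnn d) hp; rewrite subnn.
Qed.

Lemma mderiv_homin m d i p : (m <= i)%N -> homin m d p -> p^`M(i) = 0.
Proof.
move=> le_mi hp; apply/mpolyP => s; rewrite mcoeff_deriv mcoeff0.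
have [->|/hp[_ /(_ i le_mi)]] := eqVneq p@_(s + U_(i)) 0; first by rewrite mul0rn.
by rewrite mnmDE mnm1E eqxx addn1.
Qed.

Lemma mderiv_iter_Lminus m d i j p : (m <= i)%N -> homin m d p ->
  (iter j (Lminus nu m) p)^`M(i) = 0.
Proof.
move=> le_mi hp; have le_mn : (m <= n)%N := leq_trans le_mi (ltnW (ltn_ord i)).
have [le_jd|lt_dj] := leqP j d.
  exact: mderiv_homin le_mi (homin_iter_Lminus le_mn le_jd hp).
rewrite -(subnK lt_dj) iterD iter_Lminus_eq0 //.
by rewrite (_ : iter _ _ 0 = 0) ?mderiv0 //; elim: (j - _)%N => //= ? ->; rewrite linear0.
Qed.

Lemma Euler m d p : homin m d p -> \sum_(i < n | (i < m)%N) 'X_i * p^`M(i) = d%:R *: p.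
Proof.
move=> hp; apply/mpolyP => s; rewrite raddf_sum mcoeffZ /=.
have E i : ('X_i * p^`M(i))@_s = (s i)%:R * p@_s.
  rewrite mcoeff_mulX mcoeff_deriv; case: eqP => [->|/eqP si]; first by rewrite mul0r.
  have le_U : (U_(i) <= s)%MM by rewrite lep1mP.
  by rewrite submK // mnmBE mnm1E eqxx subn1 prednK ?lt0n // mulr_natl.
under eq_bigr do rewrite E.
rewrite -mulr_suml -natr_sum.
have [->|/hp[<- s0]] := eqVneq p@_s 0; first by rewrite !mulr0.
rewrite mdegE [in RHS](bigID (fun i : 'I_n => (i < m)%N)) /= [X in (_ + X)%N]big1 ?addn0 //.
by move=> i; rewrite -leqNgt => /s0.
Qed.

(* The coefficient of x_i^(j+1) in a harmonic polynomial is determined by the one of x_i^j. *)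
Lemma Lminus_inj i h : Lminus nu i.+1 h = 0 -> (forall s, s i = 0%N -> h@_s = 0) -> h = 0.
Proof.
move=> Lh0 h0; apply/mpolyP => s; rewrite mcoeff0; move def_j: (s i) => j.
elim: j s def_j => [|j IHj] s si; first exact: h0.
have le_U : (U_(i) <= s)%MM by rewrite lep1mP si.
pose s' := (s - U_(i))%MM.
have s'i : s' i = j by rewrite mnmBE mnm1E eqxx si subn1.
(* In the coefficient of L_- h at s - U_i, the terms with l different from i involve exponent j of
   x_i, so they vanish by induction; the remaining term is h@_s times a positive scalar. *)
have := congr1 (mcoeff s') Lh0; rewrite mcoeff0 mcoeff_Lminus // (bigD1 i) //=.
rewrite big1 => [|l /andP[_ ne_li]]; last first.
  by rewrite IHj ?mulr0 // mnmDE mnm1E (negPf ne_li) addn0.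
rewrite addr0 submK // s'i => /eqP; rewrite !mulf_eq0 pnatr_eq0 /= => /orP[|/eqP //].
by rewrite gt_eqF // ltr_wpDl ?ler0n // mulr_gt0 ?ltr0n // nu_ord_gt0.
Qed.

(** * CK as a bijection onto harmonic polynomials *)

Lemma pochhammer_gt0 (a : R) j : 0 < a -> 0 < pochhammer a j.
Proof. by move=> a_gt0; apply: prodr_gt0 => i _; rewrite ltr_wpDr ?ler0n. Qed.

Lemma homin_CK i d p : homin i d p -> homin i.+1 d (CK nu i.+1 d p).
Proof.
move=> hp; rewrite CK_explicit; apply: homin_sum => -[j /= lt_jd] _.
do 2!apply: hominZ; rewrite -{1}(subnKC (ltnSE lt_jd)).
apply: homin_mulXn => //; apply: homin_widen (leqnSn i) _.
by apply: homin_iter_Lminus => //; apply: ltnW.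
Qed.

(** The sum telescopes: the old L_- applied to term j cancels the Bessel operator in the new
    variable applied to term j+1. *)
Lemma Lminus_CK i d p : homin i d p -> Lminus nu i.+1 (CK nu i.+1 d p) = 0.
Proof.
move=> hp; rewrite CK_explicit LminusS !linear_sum /=.
have le_in : (i <= n)%N by apply: ltnW.
pose a j : R := ((j`!)%:R * pochhammer (2 * nu i.+1) j)^-1.
pose g j := (a j * (-1) ^+ j) *: ('X_i ^+ j * iter j.+1 (Lminus nu i) p).
have nu2_gt0 : 0 < 2 * nu i.+1 by rewrite mulr_gt0 ?ltr0n // nu_ord_gt0.
have Lg j : Lminus nu i (a j *: ((-1) ^+ j *: ('X_i ^+ j * iter j (Lminus nu i) p))) = g j.
  by rewrite !linearZ /= Lminus_mulXn // scalerA.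
have bg j : bessel nu i (a j.+1 *:
    ((-1) ^+ j.+1 *: ('X_i ^+ j.+1 * iter j.+1 (Lminus nu i) p))) = - g j.
  rewrite !linearZ /= bessel_mulXn; last exact: (mderiv_iter_Lminus j.+1 (leqnn i) hp).
  rewrite !scalerA scalerN -scaleNr; congr (_ *: _).
  have nz : (2 * nu i.+1 + j%:R != 0) by rewrite gt_eqF // ltr_wpDr ?ler0n.
  have poch_nz : pochhammer (2 * nu i.+1) j != 0 by rewrite gt_eqF // pochhammer_gt0.
  rewrite /a factS natrM {1}/pochhammer big_ord_recr /= -/(pochhammer _ j) exprS.
  by field; rewrite poch_nz nz nat1r !pnatr_eq0 -lt0n fact_gt0.
(* The two unpaired terms vanish separately: the last one of the old L_- because d+1 applications
   exhaust the degree, the first one of the Bessel operator because p does not contain x_i. *)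
rewrite big_ord_recr [X in _ + X]big_ord_recl /=.
rewrite (eq_bigr (fun j : 'I_d => g j)) => [|j _]; last exact: Lg.
rewrite [X in _ + (_ + X)](eq_bigr (fun j : 'I_d => - g j)) => [|j _]; last exact: bg.
rewrite Lg /g (iter_Lminus_eq0 _ hp) // !(mulr0, scaler0, addr0) sumrN.
rewrite addrCA subrr addr0 !linearZ /= !(expr0, mul1r).
by rewrite {1}/bessel (mderiv_homin (leqnn i) hp) mderiv0 !(mulr0, scaler0, addr0).
Qed.

Lemma mcoeff_CK0 i d p s : s i = 0%N -> (CK nu i.+1 d p)@_s = p@_s.
Proof.
move=> si; rewrite CK_explicit big_ord_recl /= mcoeffD raddf_sum /= big1 ?addr0.
  by rewrite /pochhammer big_ord0 mulr1 invr1 !scale1r mul1r.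
by move=> j _; rewrite !mcoeffZ ['X_i ^+ _]exprS -mulrA mcoeff_mulX si !mulr0.
Qed.

Lemma harm_CK i d p : homin i d p -> harm i.+1 d (CK nu i.+1 d p).
Proof. by move=> hp; split; [apply: homin_CK | apply: Lminus_CK]. Qed.

Lemma CK_inj i d p : homin i d p -> CK nu i.+1 d p = 0 -> p = 0.
Proof.
move=> hp CK0; apply/mpolyP => s; rewrite mcoeff0; apply/eqP; apply: contraT => nz.
have [_ /(_ i (leqnn i)) si] := hp s nz.
by rewrite -(mcoeff_CK0 d _ si) CK0 mcoeff0 eqxx in nz.
Qed.

(** The witness is the restriction of h to x_i = 0: h and its CK image are both killed by L_- and
    agree at x_i = 0, so [Lminus_inj] identifies them. *)
Lemma CK_surj i d h : harm i.+1 d h -> exists2 p, homin i d p & h = CK nu i.+1 d p.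
Proof.
move=> [hh Lh0]; have hp : homin i d (restrict0 i h).
  move=> s; rewrite mcoeff_restrict0; have [si | _] := eqVneq (s i) 0%N; last by rewrite eqxx.
  case/hh => deg_s s0; split=> // l; rewrite leq_eqVlt => /orP[/eqP/val_inj <- //|].
  exact: s0.
exists (restrict0 i h) => //; apply/eqP; rewrite -subr_eq0; apply/eqP.
apply: (@Lminus_inj i); first by rewrite linearB /= Lminus_CK // Lh0 subrr.
by move=> s si; rewrite mcoeffB mcoeff_CK0 // mcoeff_restrict0 si subrr.
Qed.

(** * The sl_2 relation and the Fischer decomposition in m variables *)

Section Fischer.
Variable m : nat.
Hypotheses (m_gt0 : (0 < m)%N) (le_mn : (m <= n)%N).

Let nuS := \sum_(i < n | (i < m)%N) nu i.+1.

Let nuS_gt0 : 0 < nuS.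
Proof.
have lt_0n : (0 < n)%N := leq_trans m_gt0 le_mn.
rewrite /nuS (bigD1 (Ordinal lt_0n)) //= ltr_wpDr ?nu_gt0 //.
by apply: sumr_ge0 => i _; apply/ltW/nu_ord_gt0.
Qed.

Lemma Lminus_Lplus d p : homin m d p ->
  Lminus nu m (Lplus m p) = Lplus m (Lminus nu m p) + (2 * d%:R + 2 * nuS) *: p.
Proof.
move=> hp; rewrite [Lplus m p]LplusE // [in RHS]LplusE // linear_sum /=.
rewrite scalerDl -scalerA -(Euler hp).
have E (j : 'I_n) : (j < m)%N -> Lminus nu m ('X_j * p) = 'X_j * Lminus nu m p
    + (2 *: ('X_j * p^`M(j)) + (2 * nu j.+1) *: p).
  move=> lt_jm; rewrite !LminusE // mulr_sumr.
  rewrite (bigD1 j) //= [in RHS](bigD1 j) //= bessel_mulX eqxx scale1r addrAC.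
  congr (_ + _ + _); apply: eq_bigr => i /andP[_ /negPf ne_ij].
  by rewrite bessel_mulX ne_ij scale0r addr0.
rewrite (eq_bigr _ E) big_split /=; congr (_ + _).
by rewrite big_split /= scaler_sumr -scaler_suml /nuS mulr_sumr.
Qed.

(** The sum of the sl_2 scalars 2 (e + l) + 2 [nuS] for l = 0, ..., j, collected when L_- moves past
    j+1 copies of L_+. *)
Let c e j : R := j.+1%:R * (2 * e%:R + 2 * nuS + j%:R).

Let c_neq0 e j : c e j != 0.
Proof.
rewrite mulf_neq0 ?pnatr_eq0 // gt_eqF // ltr_wpDr ?ler0n // ltr_wpDl ?mulr_ge0 ?ler0n //.
by rewrite mulr_gt0 ?ltr0n.
Qed.

Lemma Lminus_iter_Lplus e h j : harm m e h ->
  Lminus nu m (iter j.+1 (Lplus m) h) = c e j *: iter j (Lplus m) h.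
Proof.
move=> [hh Lh0]; elim: j => [|j IHj].
  by rewrite /= (Lminus_Lplus hh) Lh0 linear0 add0r /c addr0 mul1r.
rewrite [iter j.+2 _ _]/= -[Lplus m (iter _ _ _)]/(iter j.+1 _ _).
rewrite (Lminus_Lplus (@homin_iter_Lplus m _ j.+1 _ le_mn hh)) IHj linearZ /= -scalerDl.
by congr (_ *: _); rewrite /c natrD -!natr1; ring.
Qed.

(** Applying L_- kills the term j = 0 and, up to nonzero scalars, lowers every other power of L_+ by
    one. Induction on d then removes all h_j with j > 0, which leaves h_0 = 0. *)
Lemma Fischer_free d (h : nat -> {mpoly R[n]}) :
    (forall j, (j <= d)%N -> harm m (d - j) (h j)) ->
    \sum_(j < d.+1) iter j (Lplus m) (h j) = 0 ->
  forall j, (j <= d)%N -> h j = 0.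
Proof.
elim: d h => [|d IHd] h hh.
  by rewrite big_ord1 /= => h0 j; rewrite leqn0 => /eqP->.
move=> sum0; have hS j : (j <= d)%N -> h j.+1 = 0.
  move=> le_jd; have /eqP : c (d - j) j *: h j.+1 = 0; last first.
    by rewrite scaler_eq0 (negPf (c_neq0 _ _)) => /eqP.
  apply: (IHd (fun j => c (d - j) j *: h j.+1)) => // [l le_ld|].
    by apply: harmZ; rewrite -subSS; apply: hh.
  have := congr1 (Lminus nu m) sum0; rewrite linear0 linear_sum big_ord_recl /=.
  rewrite (hh 0%N _).2 // add0r => L0; rewrite -[RHS]L0; apply: eq_bigr => -[l /= lt_ld] _.
  have := hh l.+1 lt_ld; rewrite subSS linearZ => /Lminus_iter_Lplus hl.
  exact: esym (hl l).
case=> [_|j]; last exact: hS.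
move: sum0; rewrite big_ord_recl /= big1 ?addr0 // => -[j lt_jd] _.
by rewrite [h _]hS //; exact: (linear0 (iter j.+1 (Lplus m))).
Qed.

(** Decompose L_- p by induction and lift each L_+^j g_j to a multiple of L_+^(j+1) g_j. The lifted
    sum q has the same image as p under L_-, so p - q is the missing harmonic term. *)
Lemma Fischer_span d p : homin m d p ->
  exists2 h : nat -> {mpoly R[n]}, (forall j, (j <= d)%N -> harm m (d - j) (h j)) &
    p = \sum_(j < d.+1) iter j (Lplus m) (h j).
Proof.
elim: d p => [|d IHd] p hp.
  exists (fun=> p); last by rewrite big_ord1.
  by move=> j _; split=> //; apply: Lminus_homin0.
have [g hg Lp] := IHd _ (homin_Lminus le_mn hp).
pose h j := (c (d - j) j)^-1 *: g j.
have hh j : (j <= d)%N -> harm m (d - j) (h j).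
  by move=> /hg; apply: harmZ.
pose q := \sum_(j < d.+1) iter j.+1 (Lplus m) (h j).
exists (fun j => if j is j'.+1 then h j' else p - q); last first.
  by rewrite big_ord_recl; exact: esym (subrK q p).
case=> [_|j le_jd]; last by rewrite subSS; apply: hh.
split.
  apply: hominB => //; apply: homin_sum => -[j /= lt_jd] _.
  have [hhj _] := hh j lt_jd.
  by have := @homin_iter_Lplus m _ j.+1 _ le_mn hhj; rewrite addSn subnKC.
suff Lq : Lminus nu m q = Lminus nu m p by rewrite linearB /= Lq subrr.
rewrite Lp linear_sum; apply: eq_bigr => -[j lt_jd] _.
rewrite [LHS](Lminus_iter_Lplus j (hh j lt_jd)) linearZ /=.
by rewrite scalerA divff ?c_neq0 // scale1r.
Qed.

End Fischer.
End Harmonics.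

(** * Induction on the number of variables: freeness and spanning *)

Section Basis.
Variables (R : realFieldType) (n k : nat) (nu : nat -> R).
Hypothesis nu_gt0 : forall j, (1 <= j <= n)%N -> 0 < nu j.
Local Notation index := {ffun 'I_n.-1 -> 'I_k.+1}.
Implicit Types (t : index) (m d j : nat) (u : nat -> nat).

(* Starting from 1 instead of the junk value [phi nu t 1 = 0] makes the recursion of [phi] uniform:
   x_1^j = (L_+^[1])^j 1. *)
Definition phi1 t m : {mpoly R[n]} := if m == 1%N then 1 else phi nu t m.

Lemma phi1S t m : (0 < m)%N ->
  phi1 t m.+1 = CK nu m.+1 (\sum_(1 <= l < m.+1) jidx t l)
                  (iter (jidx t m) (Lplus m) (phi1 t m)).
Proof.
case: m => [//|[|m]] _ //=; rewrite /phi1 /= big_nat1; congr CK.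
by elim: (jidx t 1) => //= j <-; rewrite /Lplus big_nat1 exprS.
Qed.

(* The entries from j_m on are frozen to u, so that the induction on m keeps one index type. *)
Definition fiber m d u t : bool :=
  (\sum_(1 <= l < m) jidx t l == d)%N && [forall l : 'I_n, (m <= l)%N ==> (jidx t l == u l)].

Definition update u m j : nat -> nat := fun l => if l == m then j else u l.

Lemma fiberS m d u j t : (0 < m < n)%N -> (j <= d)%N ->
  fiber m.+1 d u t && (jidx t m == j) = fiber m (d - j) (update u m j) t.
Proof.
move=> /andP[m_gt0 lt_mn] le_jd; rewrite /fiber big_nat_recr //=.
apply/andP/andP => [[/andP[/eqP sum_t /forallP tu] /eqP tm] | [/eqP sum_t /forallP tu]].
  split; first by rewrite -sum_t tm addnK.
  apply/forallP => l; apply/implyP; rewrite leq_eqVlt /update eq_sym.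
  case: eqP => [-> _ | _ /= lt_ml]; first by rewrite tm.
  exact: (implyP (tu l)).
have tm : jidx t m = j.
  by have /implyP/(_ (leqnn m))/eqP := tu (Ordinal lt_mn); rewrite /update /= eqxx.
rewrite tm eqxx sum_t subnK // eqxx; split=> //; apply/forallP => l; apply/implyP => lt_ml.
by have /implyP/(_ (ltnW lt_ml)) := tu l; rewrite /update (gtn_eqF lt_ml).
Qed.

Lemma harm_phi1 m d u t : (0 < m <= n)%N -> fiber m d u t -> harm nu m d (phi1 t m).
Proof.
move=> /andP[m_gt0 le_mn] /andP[/eqP <- _].
elim: m m_gt0 le_mn => [//|[_|m IHm]] _ le_mn.
  rewrite big_geq // /phi1 eqxx.
  have h1 : homin 1 0 (1 : {mpoly R[n]}).
    move=> s; rewrite mcoeff1; case: (s =P 0%MM) => [-> _ | _]; last by rewrite eqxx.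
    by split=> [|i _]; rewrite ?mdeg0 ?mnm0E.
  by split=> //; apply: Lminus_homin0.
rewrite phi1S //; apply: (harm_CK nu_gt0 (i := Ordinal le_mn)).
have [h _] := IHm isT (ltnW le_mn).
by rewrite big_nat_recr //= addnC; apply: homin_iter_Lplus (ltnW le_mn) h.
Qed.

Lemma jidxE t (l : 'I_n.-1) : jidx t l.+1 = t l.
Proof. by rewrite /jidx /= valK. Qed.

(** At m = 1 every entry is frozen, so the base case of the induction has at most one index. *)
Lemma fiber1_inj d u t t' : fiber 1 d u t -> fiber 1 d u t' -> t = t'.
Proof.
move=> /andP[_ /forallP tu] /andP[_ /forallP tu']; apply/ffunP => l; apply: val_inj.
have lt_ln : (l.+1 < n)%N by rewrite -ltn_predRL.
have /implyP/(_ isT)/eqP := tu (Ordinal lt_ln).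
have /implyP/(_ isT)/eqP := tu' (Ordinal lt_ln).
by rewrite /= !jidxE => -> ->.
Qed.

Lemma fiber1_ex u : (forall l, (0 < l < n)%N -> (u l <= k)%N) -> exists t, fiber 1 0 u t.
Proof.
move=> u_le; exists [ffun l : 'I_n.-1 => inord (u l.+1)]; rewrite /fiber big_geq //=.
apply/forallP => -[[|l] lt_ln] //=.
have lt_ln1 : (l < n.-1)%N by rewrite ltn_predRL.
rewrite (jidxE _ (Ordinal lt_ln1)) ffunE /= inordK // ltnS; exact: u_le.
Qed.

(** Group a relation by the value j of the last summed entry. Injectivity of CK and uniqueness of
    the Fischer decomposition make each group vanish, and each group is a relation in one variable
    fewer. *)
Lemma phi1_free m d u (c : index -> R) : (0 < m <= n)%N ->
  \sum_(t | fiber m d u t) c t *: phi1 t m = 0 -> forall t, fiber m d u t -> c t = 0.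
Proof.
move=> /andP[m_gt0 le_mn]; elim: m m_gt0 le_mn d u c => [//|[_|m IHm]] _ le_mn d u c.
  move=> sum0 t ft; move: sum0; rewrite (bigD1 t) //= big1 => [|t' /andP[ft' /eqP[]]].
    rewrite addr0 /phi1 eqxx => /eqP; rewrite scaler_eq0 oner_eq0 orbF.
    by move/eqP.
  exact: fiber1_inj ft' ft.
(* The group of index j, stripped of CK and L_+^j: the candidate harmonic Fischer component. *)
pose i := Ordinal le_mn; pose h j : {mpoly R[n]} :=
  \sum_(t | fiber m.+1 (d - j) (update u m.+1 j) t) c t *: phi1 t m.+1.
have le_mn' := ltnW le_mn.
have hh j : (j <= d)%N -> harm nu m.+1 (d - j) (h j).
  move=> le_jd; rewrite /h; split.
    apply: homin_sum => t /harm_phi1 ht; apply: hominZ.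
    by case: ht.
  rewrite linear_sum big1 // => t /harm_phi1 ht; rewrite linearZ /=.
  by case: ht => // _ ->; rewrite scaler0.
have t_le t : fiber m.+2 d u t -> (jidx t m.+1 <= d)%N.
  by move=> /andP[/eqP <- _]; rewrite big_nat_recr //= leq_addl.
have sum_h : \sum_(t | fiber m.+2 d u t) c t *: phi1 t m.+2
    = CK nu i.+1 d (\sum_(j < d.+1) iter j (Lplus m.+1) (h j)).
  rewrite linear_sum (partition_big (fun t => inord (jidx t m.+1) : 'I_d.+1) xpredT) //=.
  apply: eq_bigr => j _; rewrite /h linear_sum (linear_sum (CK nu i.+1 d)).
  apply: eq_big => [t | t /andP[ft /eqP def_j]].
    rewrite -fiberS ?le_mn //; last exact: ltnSE.
    apply: andb_id2l => ft; rewrite -val_eqE /= inordK // ltnS; exact: t_le.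
  rewrite linearZ (linearZ_LR (CK nu i.+1 d)) phi1S //=; congr (_ *: _).
  case/andP: (ft) => /eqP -> _.
  by rewrite -def_j inordK // ltnS t_le.
rewrite sum_h => CK0 t ft.
have sum0 : \sum_(j < d.+1) iter j (Lplus m.+1) (h j) = 0.
  apply: (CK_inj (i := i) _ CK0); apply: homin_sum => -[j /= lt_jd] _.
  by rewrite -{1}(subnKC (ltnSE lt_jd)); apply: homin_iter_Lplus => //; apply: (hh _ _).1.
have le_td := t_le t ft.
apply: (IHm isT le_mn' (d - jidx t m.+1)%N (update u m.+1 (jidx t m.+1)) c).
  exact: (Fischer_free nu_gt0 (ltn0Sn m) le_mn' hh sum0 le_td).
by rewrite -fiberS ?ft ?le_mn ?eqxx.
Qed.

(* Spanning is phrased through linearly closed predicates W, so that the induction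
   can pull W back along p |-> CK (L_+^j p). *)
Lemma phi1_span m d u (W : {mpoly R[n]} -> Prop) p : (0 < m <= n)%N -> (d <= k)%N ->
    (forall l, (m <= l < n)%N -> (u l <= k)%N) ->
    W 0 -> (forall q r, W q -> W r -> W (q + r)) -> (forall a q, W q -> W (a *: q)) ->
    (forall t, fiber m d u t -> W (phi1 t m)) ->
  harm nu m d p -> W p.
Proof.
move=> /andP[m_gt0 le_mn].
elim: m m_gt0 le_mn d u W p => [//|[_|m IHm]] _ le_mn d u W p le_dk u_le W0 WD WZ Wphi hp.
  case: d => [|d] in le_dk Wphi hp *.
    have [t ft] := fiber1_ex u_le.
    (* In degree 0 only constants occur, spanned by [phi1 t 1] = 1. *)
    have -> : p = p@_0 *: 1.
      apply/mpolyP => s; rewrite mcoeffZ mcoeff1.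
      case: (s =P 0%MM) => [-> | /eqP s_neq0]; first by rewrite mulr1.
      rewrite mulr0; apply/eqP; apply: contraT => /hp.1[/eqP].
      by rewrite mdeg_eq0 (negPf s_neq0).
    by apply: WZ; have := Wphi t ft; rewrite /phi1 eqxx.
  suff -> : p = 0 by [].
  (* In x_1 alone, a monomial free of x_1 has degree 0, so a harmonic polynomial of positive degree
     vanishes at x_1 = 0 and hence everywhere. *)
  apply: (Lminus_inj nu_gt0 (i := Ordinal le_mn)) hp.2 _ => s s0.
  apply/eqP; apply: contraT => /hp.1[deg_s s_eq0].
  have : mdeg s = 0%N; last by rewrite deg_s.
  rewrite mdegE big1 // => l _; have [l0 | /s_eq0 //] := posnP l.
  by rewrite -[RHS]s0; congr (s _); apply: val_inj.
have [q hq ->] := CK_surj nu_gt0 (i := Ordinal le_mn) hp.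
have le_mn' := ltnW le_mn.
have [h hh ->] := Fischer_span nu_gt0 (ltn0Sn m) le_mn' hq.
rewrite linear_sum; apply: big_ind => // -[j lt_jd] _.
have le_jd := ltnSE lt_jd; have le_jk := leq_trans le_jd le_dk.
apply: (IHm isT le_mn' (d - j)%N (update u m.+1 j)
  (fun q => W (CK nu m.+2 d (iter j (Lplus m.+1) q)))) (hh j le_jd).
- exact: leq_trans (leq_subr _ _) le_dk.
(* The newly frozen value j is at most d, hence at most k, so it still fits in the index type. *)
- move=> l /andP[le_ml lt_ln]; rewrite /update; case: eqP => // /eqP ne_lm.
  by apply: u_le; rewrite lt_ln ltn_neqAle eq_sym ne_lm le_ml.
- by rewrite linear0 (linear0 (CK nu (Ordinal le_mn).+1 d)).
- by move=> q1 q2 W1 W2; rewrite linearD (linearD (CK nu (Ordinal le_mn).+1 d)); apply: WD.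
- by move=> a q1 W1; rewrite linearZ (linearZ_LR (CK nu (Ordinal le_mn).+1 d)); apply: WZ.
move=> t; rewrite -fiberS ?le_mn // => /andP[ft /eqP tj].
have := Wphi t ft; rewrite phi1S // tj.
by case/andP: ft => /eqP ->.
Qed.

End Basis.

(** * Specialisation to all n variables and degree k *)

Theorem theorem4p3 (R : realFieldType) (n k : nat) (nu : nat -> R)
  (hn : (2 <= n)%N) (hnu : forall j, (1 <= j <= n)%N -> 0 < nu j) :
  (* every psi lies in H^BG_k(R^n) *)
  (forall t : {ffun 'I_n.-1 -> 'I_k.+1}, idx_ok t -> HBG nu k (psiBG nu t)) /\
  (* linear independence *)
  (forall c : {ffun 'I_n.-1 -> 'I_k.+1} -> R,
     \sum_(t | idx_ok t) c t *: psiBG nu t = 0 ->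
     forall t : {ffun 'I_n.-1 -> 'I_k.+1}, idx_ok t -> c t = 0) /\
  (* spanning *)
  (forall p : {mpoly R[n]}, HBG nu k p ->
     exists c : {ffun 'I_n.-1 -> 'I_k.+1} -> R,
       p = \sum_(t | idx_ok t) c t *: psiBG nu t).
Proof.
have n_gt0 : (0 < n <= n)%N by rewrite leqnn andbT ltnW.
have phiE (t : {ffun 'I_n.-1 -> 'I_k.+1}) : phi1 nu t n = psiBG nu t by rewrite /phi1 gtn_eqF.
(* At m = n no entry is frozen, so the choice of u is immaterial. *)
have fiberE : fiber n k (fun=> 0%N) =1 @idx_ok n k.
  move=> t; rewrite /fiber /idx_ok (_ : [forall l, _]) ?andbT; last first.
    by apply/forallP => l; rewrite leqNgt ltn_ord.
  rewrite big_add1 big_mkord; congr (_ == _).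
  by apply: eq_bigr => l _; rewrite jidxE.
have HBG_harm (p : {mpoly R[n]}) : HBG nu k p <-> harm nu n k p.
  split=> -[hp Lp]; split=> //.
    move=> s nz; split; last by move=> i; rewrite leqNgt ltn_ord.
    by apply: (dhomogP _ _ _ hp); rewrite mcoeff_msupp.
  by apply/dhomogP => s; rewrite mcoeff_msupp => /hp[].
split=> [t|]; first by rewrite -fiberE -phiE => /(harm_phi1 hnu n_gt0)/HBG_harm.
split=> [c sum0 t | p /HBG_harm hp].
  rewrite -fiberE; apply: (phi1_free hnu n_gt0); rewrite -[RHS]sum0.
  by apply: eq_big => // t' _; rewrite phiE.
(* [W] is membership in the span of the psi; it is closed under linear operations and contains each
   psi by an indicator coefficient family. *)
pose W q := exists c : {ffun 'I_n.-1 -> 'I_k.+1} -> R,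
  q = \sum_(t | idx_ok t) c t *: psiBG nu t.
apply: (phi1_span hnu (u := fun=> 0%N) (W := W) n_gt0 (leqnn k) _ _ _ _ _ hp) => [|||a q|t] //.
- by exists (fun=> 0); rewrite big1 // => t _; rewrite scale0r.
- move=> q r [a ->] [b ->]; exists (fun t => a t + b t); rewrite -big_split.
  by apply: eq_bigr => t _; rewrite scalerDl.
- move=> [b ->]; exists (fun t => a * b t); rewrite scaler_sumr.
  by apply: eq_bigr => t _; rewrite scalerA.
rewrite fiberE phiE => ok_t; exists (fun t' => (t' == t)%:R).
rewrite (bigD1 t) //= eqxx scale1r big1 ?addr0 // => t' /andP[_ /negPf ->].
by rewrite scale0r.
Qed.
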